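(* Let $\&$ be a continuous t-norm on $[0,1]$ and let $\mathsf{Q}=([0,1],\&,1)$. Then the following are equivalent: (1) $\&$ is Archimedean. (2) For each $\mathsf{Q}$-category $X$, $X$ is Yoneda complete if and only if $\mathbf{B}X$ is directed complete.
   Context: A continuous t-norm on $[0,1]$ is a binary operation $\&\colon[0,1]\times[0,1]\to[0,1]$, continuous for the usual topology, such that $([0,1],\&,1)$ is a commutative monoid and $p\,\&\,(-)$ preserves arbitrary joins for every $p$; so $\mathsf{Q}=([0,1],\&,1)$ is a commutative unital quantale with unit $1$. A continuous t-norm is Archimedean if for all $x,y\in(0,1)$ there is a positive integer $n$ with $x^n<y$, where $x^n=x\,\&\,\cdots\,\&\,x$ ($n$ times). A $\mathsf{Q}$-category is a set $X$ with a map $X\times X\to[0,1]$, $(x,y)\mapsto X(x,y)$, such that $X(x,x)=1$ and $X(y,z)\,\&\,X(x,y)\le X(x,z)$ for all $x,y,z\in X$. A formal ball of $X$ is a pair $(x,r)$ with $x\in X$, $r\in[0,1]$ (the radius $r$ may be $0$). $\mathbf{B}X$ is the set of all formal balls of $X$ with the preorder: $(x,r)\le(y,s)$ iff $r\le s\,\&\,X(x,y)$. $\mathbf{B}X$ is directed complete if each directed (in particular non-empty) subset of it has a join; a join in a preordered set is a least upper bound (unique only up to equivalence $a\le b\le a$). A net $(x_\lambda)_{\lambda\in D}$ in $X$ is forward Cauchy if $\bigvee_\lambda\bigwedge_{\lambda\le\gamma\le\mu}X(x_\gamma,x_\mu)=1$. An element $a\in X$ is a Yoneda limit of $(x_\lambda)_{\lambda\in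 D}$ if $X(a,y)=\bigvee_\lambda\bigwedge_{\mu\ge\lambda}X(x_\mu,y)$ for all $y\in X$. $X$ is Yoneda complete if every forward Cauchy net in $X$ has a Yoneda limit. *)

(* Defs.v *)
From HB Require Import structures.
From mathcomp Require Import all_boot all_order all_algebra.
From mathcomp Require Import interval_inference.
From mathcomp Require Import all_classical reals topology normedtype.

Set Implicit Arguments.
Unset Strict Implicit.
Unset Printing Implicit Defensive.

Import Order.TTheory GRing.Theory Num.Theory.
Import numFieldNormedType.Exports.

Local Open Scope classical_set_scope.
Local Open Scope ring_scope.

Section UnitInterval.
Variable R : realType.

(* The interval carries the subspace topology of R. *)
Local Notation i01_top := (initial_topology (fun x : {i01 R} => x%:num)).

(* Joins and meets in the complete lattice [0,1]: the defaults are the join and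
   the meet of the empty set. *)
Definition qsup (A : set {i01 R}) : {i01 R} := supremum 0%:i01 A.
Definition qinf (A : set {i01 R}) : {i01 R} := infimum 1%:i01 A.

Lemma qsupP (A : set {i01 R}) : supremums A (qsup A).
Proof.
rewrite /qsup /supremum; case: ifPn => [/eqP ->|/set0P[a Aa]].
  by split=> // x _; rewrite -num_le /=; exact: ge0.
pose B := [set x%:num | x in A].
have hB : has_sup B.
  split; first by exists a%:num, a.
  exists 1 => _ [x _ <-]; exact: le1.
have s0 : 0 <= sup B.
  by apply: le_trans (ge0 a) _; apply: ub_le_sup; [case: hB|exists a].
have s1 : sup B <= 1.
  by apply: ge_sup; [case: hB|move=> _ [x _ <-]; exact: le1].
have HS : supremums A (Itv01 s0 s1).
  split=> [x Ax|y Ay]; rewrite -num_le /=.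
    by apply: ub_le_sup; [case: hB|exists x].
  apply: ge_sup; first by case: hB.
  by move=> _ [x Ax <-]; rewrite num_le; exact: Ay.
by case: xgetP => [y _ //|/(_ _ HS)].
Qed.

Lemma qinfP (A : set {i01 R}) : infimums A (qinf A).
Proof.
rewrite /qinf /infimum; case: ifPn => [/eqP ->|/set0P[a Aa]].
  by split=> // x _; rewrite -num_le /=; exact: le1.
have HS : infimums A (qsup (lbound A)).
  have [u l] := qsupP (lbound A).
  by split=> // x Ax; apply: l => y; exact.
by case: xgetP => [y _ //|/(_ _ HS)].
Qed.

Variable op : {i01 R} -> {i01 R} -> {i01 R}.

Record continuous_tnorm : Prop := ContinuousTnorm {
  tnorm_continuous : continuous (fun p : i01_top * i01_top =>
                                   (op p.1 p.2 : i01_top)) ;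
  tnormA : associative op ;
  tnormC : commutative op ;
  tnorm1 : left_id 1%:i01 op ;
  tnorm_sup : forall (p : {i01 R}) (A : set {i01 R}),
      op p (qsup A) = qsup [set op p x | x in A] }.

Definition tpow (x : {i01 R}) (n : nat) : {i01 R} := iter n (op x) 1%:i01.

Definition archimedean_tnorm : Prop :=
  forall x y : {i01 R}, 0 < x%:num < 1 -> 0 < y%:num < 1 ->
    exists n : nat, (0 < n)%N /\ tpow x n < y.

Record qcat : Type := QCat {
  qobj :> Type ;
  qhom : qobj -> qobj -> {i01 R} ;
  qhom_refl : forall x, qhom x x = 1%:i01 ;
  qhom_trans : forall x y z, op (qhom y z) (qhom x y) <= qhom x z }.

End UnitInterval.

(* A nonempty subset A of T in which any two elements have an upper bound. *)
Definition directed_set (T : Type) (le : T -> T -> Prop) (A : set T) : Prop :=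
  A !=set0 /\
  forall a b, A a -> A b -> exists c, [/\ A c, le a c & le b c].

(* Least upper bounds for a relation that need not be antisymmetric, so they
   are determined only up to equivalence. *)
Definition is_join (T : Type) (le : T -> T -> Prop) (A : set T) (j : T) :
  Prop :=
  (forall a, A a -> le a j) /\
  (forall b, (forall a, A a -> le a b) -> le j b).

Definition directed_complete (T : Type) (le : T -> T -> Prop) : Prop :=
  forall A : set T, directed_set le A -> exists j, is_join le A j.

Section QCategory.
Variables (R : realType) (op : {i01 R} -> {i01 R} -> {i01 R}) (X : qcat op).

Definition formal_ball : Type := (X * {i01 R})%type.

Definition ball_le (b c : formal_ball) : Prop :=
  b.2 <= op c.2 (qhom b.1 c.1).

Definition forward_cauchy (D : Type) (le : D -> D -> Prop) (x : D -> X) :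
  Prop :=
  qsup (range (fun l => qinf [set e | exists g m,
    [/\ le l g, le g m & e = qhom (x g) (x m)]])) = 1%:i01.

Definition yoneda_limit (D : Type) (le : D -> D -> Prop) (x : D -> X) (a : X) :
  Prop :=
  forall y : X, qhom a y =
    qsup (range (fun l => qinf [set qhom (x m) y | m in le l])).

(* Nets are indexed by nonempty directed preordered sets. *)
Definition yoneda_complete : Prop :=
  forall (D : Type) (le : D -> D -> Prop),
    RelationClasses.PreOrder le -> directed_set le [set: D] ->
    forall x : D -> X, forward_cauchy le x -> exists a, yoneda_limit le x a.

End QCategory.

(* Main.v *)
(* For an Archimedean continuous t-norm, [c & w = c] with [w < 1] forces
   [c = 0]; together with divisibility this gives cancellation of [a] in
   [a & u <= a & v] whenever [a & u] is nonzero. Hence the centers of a directed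
   family of balls whose radii have a nonzero join form a forward Cauchy net.
   Conversely, a forward Cauchy net (x_l) yields, for each [t], a directed family
   of balls (x_l, t & r) with radii of join [t]; cancellation identifies the
   centers of the joins for different [t], and the family with
   [t = liminf X(x_l, y)] computes [X(a, y)].
   Without the Archimedean property there is an idempotent [e] in (0,1). The
   chain of natural numbers with [X(n, m) = e] for [n < m] and [0] for [n > m]
   is Yoneda complete, because its forward Cauchy nets are eventually constant,
   but the balls (n, e) form a chain without upper bound. *)
Require Import Defs.
From mathcomp Require Import all_boot all_order all_algebra.
From mathcomp Require Import interval_inference reals.
From mathcomp Require Import all_classical topology normedtype.

Set Implicit Arguments.
Unset Strict Implicit.
Unset Printing Implicit Defensive.

Import Order.TTheory GRing.Theory Num.Theory.
Import numFieldNormedType.Exports.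

(** * Joins, meets and density in the unit interval *)

Section UnitIntervalLattice.
Local Open Scope classical_set_scope.
Local Open Scope ring_scope.
Context {R : realType}.
Implicit Types (A : set {i01 R}) (a c t u : {i01 R}).

Lemma i01_ge0 a : 0%:i01 <= a.
Proof. by rewrite -num_le /=; exact: ge0. Qed.

Lemma i01_le1 a : a <= 1%:i01.
Proof. by rewrite -num_le /=; exact: le1. Qed.

Lemma i01_lt01 : 0%:i01 < 1%:i01 :> {i01 R}.
Proof. exact: ltr01. Qed.

Lemma i01_dense t u : t < u -> exists2 m : {i01 R}, t < m & m < u.
Proof.
rewrite -num_lt => tu.
have [tm mu] := midf_lt tu.
have m0 : 0 <= (t%:num + u%:num) / 2 by rewrite (le_trans _ (ltW tm)).
have m1 : (t%:num + u%:num) / 2 <= 1 by rewrite (le_trans (ltW mu)).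
by exists (Itv01 m0 m1); rewrite -num_lt.
Qed.

Lemma qsup_ub A a : A a -> a <= qsup A.
Proof. by have [ub _] := qsupP A; exact: ub. Qed.

Lemma qsup_le A c : (forall a, A a -> a <= c) -> qsup A <= c.
Proof. by have [_ lub] := qsupP A; exact: lub. Qed.

Lemma qinf_lb A a : A a -> qinf A <= a.
Proof. by have [lb _] := qinfP A; exact: lb. Qed.

Lemma qinf_ge A c : (forall a, A a -> c <= a) -> c <= qinf A.
Proof. by have [_ glb] := qinfP A; exact: glb. Qed.

Lemma qsup_gt A t : t < qsup A -> exists2 a, A a & t < a.
Proof.
move=> tA; apply: contrapT => nA.
suff : qsup A <= t by rewrite leNgt tA.
apply: qsup_le => a Aa; rewrite leNgt; apply/negP => ta.
by apply: nA; exists a.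
Qed.

(** By density. Later it reduces a bound on [p] to bounds on [op p t] for all [t < 1]. *)
Lemma qsup_lt1 : qsup [set t : {i01 R} | t < 1%:i01] = 1%:i01.
Proof.
apply/eqP; rewrite eq_le i01_le1 leNgt; apply/negP => /i01_dense[m sm m1].
by have := @qsup_ub [set t | t < 1%:i01] m m1; rewrite leNgt sm.
Qed.

End UnitIntervalLattice.

(** * Monotonicity, divisibility and idempotents of a continuous t-norm *)

Section ContinuousTNorm.
Local Open Scope classical_set_scope.
Local Open Scope ring_scope.
Context {R : realType} {op : {i01 R} -> {i01 R} -> {i01 R}}.
Hypothesis hop : continuous_tnorm op.
Implicit Types (A : set {i01 R}) (a c p q s t u v w : {i01 R}).

Let opA := tnormA hop.
Let opC := tnormC hop.
Let op1l : left_id 1%:i01 op := tnorm1 hop.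

Lemma tnorm1r : right_id 1%:i01 op.
Proof. by move=> p; rewrite opC op1l. Qed.

(** Monotonicity comes from preservation of the join of the pair [q1], [q2]. *)
Lemma tnorm_lel p q1 q2 : q1 <= q2 -> op p q1 <= op p q2.
Proof.
move=> q12; have -> : q2 = qsup [set q | q = q1 \/ q = q2].
  apply/eqP; rewrite eq_le qsup_ub /=; last by right.
  by apply: qsup_le => _ [|] ->.
by rewrite (tnorm_sup hop); apply: qsup_ub; exists q1 => //; left.
Qed.

Lemma tnorm_ler q p1 p2 : p1 <= p2 -> op p1 q <= op p2 q.
Proof. by move=> p12; rewrite 2!(opC _ q); exact: tnorm_lel. Qed.

Lemma tnorm_le_left p q : op p q <= p.
Proof. by rewrite -[leRHS]tnorm1r; apply: tnorm_lel; exact: i01_le1. Qed.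

Lemma tnorm_le_right p q : op p q <= q.
Proof. by rewrite opC; exact: tnorm_le_left. Qed.

Lemma tnorm_sup_le p A c :
  (forall a, A a -> op p a <= c) -> op p (qsup A) <= c.
Proof.
by move=> H; rewrite (tnorm_sup hop); apply: qsup_le => _ [a Aa <-]; exact: H.
Qed.

Lemma tnorm_lt_sup p A c : c < op p (qsup A) -> exists2 a, A a & c < op p a.
Proof.
by rewrite (tnorm_sup hop) => /qsup_gt[_ [a Aa <-] ca]; exists a.
Qed.

(** Topological continuity enters here: if [op p (qinf A) < c], the same holds on a neighbourhood of
    [qinf A], which meets [A]. *)
Lemma tnorm_inf_ge p A c : A !=set0 ->
  (forall a, A a -> c <= op p a) -> c <= op p (qinf A).
Proof.
move=> [a0 Aa0] H; rewrite leNgt; apply/negP => lt_c.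
pose I := initial_topology (fun x : {i01 R} => x%:num).
have cp : continuous (fun x : I => (op p x : I)).
  move=> x.
  apply: (@continuous2_cvg I I I I (nbhs x) _ (fun=> p) id op p x).
  - exact: (@tnorm_continuous _ _ hop (p, x)).
  - exact: cvg_cst.
  - exact: cvg_id.
have cv : continuous (fun x : I => (op p x)%:num).
  move=> x; apply: (@continuous_comp _ _ _ _ (fun z : I => z%:num : R)).
    exact: cp.
  exact: initial_continuous.
have : nbhs (qinf A : I) [set x | (op p x)%:num < c%:num].
  exact: (cvgr_lt _ (cv (qinf A)) _ lt_c).
rewrite nbhsE => -[U [oU UA] Us].
case: oU => V oV VU.
have : nbhs ((qinf A)%:num : R) V.
  rewrite -VU in UA; apply: open_nbhs_nbhs; split; [exact: oV|exact: UA].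
rewrite -nbhs_ballE => -[e e0 eV].
(* Otherwise [qinf A + e] is a lower bound of [A]; the element [a0] keeps it within the unit
   interval. *)
have [a Aa lta] : exists2 a, A a & a%:num < (qinf A)%:num + e.
  apply: contrapT => nA.
  have se : (qinf A)%:num + e <= a0%:num.
    by rewrite leNgt; apply/negP => ?; apply: nA; exists a0.
  have s0 : 0 <= (qinf A)%:num + e by rewrite addr_ge0// ltW.
  have s1 : (qinf A)%:num + e <= 1 by apply: (le_trans se).
  have : Itv01 s0 s1 <= qinf A.
    apply: qinf_ge => a Aa; rewrite -num_le /= leNgt; apply/negP => ?.
    by apply: nA; exists a.
  by rewrite -num_le /= leNgt ltrDl e0.
have : U a.
  rewrite -VU; apply: eV; rewrite /ball /= distrC ger0_norm; last first.
    by rewrite subr_ge0 num_le; exact: qinf_lb.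
  by rewrite ltrBlDl.
by move/Us => /=; rewrite num_lt ltNge H.
Qed.

(** Divisibility: [w] is the largest element with [op v w <= u]. If [w < 1], it is the infimum of
    the elements above it, all of which [op v] sends above [u]. *)
Lemma tnorm_factor u v : u <= v -> exists w, u = op v w.
Proof.
move=> uv; pose w := qsup [set w | op v w <= u]; exists w.
have le_u : op v w <= u by exact: tnorm_sup_le.
apply/eqP; rewrite eq_le le_u andbT.
have [->|w1] := eqVneq w 1%:i01; first by rewrite tnorm1r.
have lw1 : w < 1%:i01 by rewrite lt_neqAle w1 i01_le1.
have -> : w = qinf [set x | w < x].
  apply/eqP; rewrite eq_le qinf_ge /=; last by move=> a /ltW.
  rewrite leNgt; apply/negP => /i01_dense[m wm].
  by apply/negP; rewrite -leNgt; exact: qinf_lb.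
apply: tnorm_inf_ge => [|x wx]; first by exists 1%:i01.
rewrite leNgt; apply/negP => /ltW xu; move: wx.
by apply/negP; rewrite -leNgt; exact: qsup_ub.
Qed.

Lemma tpow_add x m n : tpow op x (m + n)%N = op (tpow op x m) (tpow op x n).
Proof.
elim: m => [|m IH]; first by rewrite add0n /tpow /= op1l.
by rewrite addSn /tpow /= -/(tpow _ _ _) IH opA.
Qed.

(** If all powers of [x] stay above [y], their infimum is idempotent, since products of powers are
    powers. *)
Lemma idempotent_of_not_archimedean : ~ archimedean_tnorm op ->
  exists e, [/\ 0%:i01 < e, e < 1%:i01 & op e e = e].
Proof.
move=> /existsNP[x] /existsNP[y] /not_implyP[/andP[_ x1]].
move=> /not_implyP[/andP[y0 _]] nxy.
have yx n : y <= tpow op x n.+1.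
  by rewrite leNgt; apply/negP => ?; apply: nxy; exists n.+1.
pose P := range (fun n => tpow op x n.+1).
have Px n : P (tpow op x n.+1) by exists n.
have P0 : P !=set0 by exists (tpow op x 1); exact: Px.
exists (qinf P); split.
- apply: (@lt_le_trans _ _ y); first by rewrite -num_lt.
  by apply: qinf_ge => _ [n _ <-].
- apply: (@le_lt_trans _ _ x); last by rewrite -num_lt.
  by apply: qinf_lb; exists 0%N => //; rewrite /tpow /= tnorm1r.
- apply/eqP; rewrite eq_le tnorm_le_left /=.
  apply: tnorm_inf_ge => // _ [n _ <-].
  rewrite opC; apply: tnorm_inf_ge => // _ [m _ <-].
  by rewrite -tpow_add; apply: qinf_lb; rewrite addnS; exact: Px.
Qed.

(** * Cancellation in the Archimedean case *)

Section Archimedean.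
Hypothesis arch : archimedean_tnorm op.

(** Iterating gives [c = op c (tpow op w n)], so [c] lies below every power of [w]. *)
Lemma tnorm_absorb c w : op c w = c -> w < 1%:i01 -> c = 0%:i01.
Proof.
move=> cw w1; apply/eqP; rewrite eq_le i01_ge0 andbT leNgt; apply/negP => c0.
have cn n : c <= tpow op w n.
  suff -> : c = op c (tpow op w n) by exact: tnorm_le_right.
  by elim: n => [|n IH]; rewrite /tpow /= ?tnorm1r// opA cw.
have c1 : c < 1%:i01.
  by apply: le_lt_trans w1; rewrite -cw; exact: tnorm_le_right.
have w0 : 0%:i01 < w.
  by apply: lt_le_trans c0 _; rewrite -cw; exact: tnorm_le_right.
have [||n [_]] := @arch w c.
- by apply/andP; split; [exact: w0|exact: w1].
- by apply/andP; split; [exact: c0|exact: c1].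
- by rewrite ltNge cn.
Qed.

(** If [v < u], divisibility gives [v = op u w] with [w < 1], and then [op a u] absorbs [w]. *)
Lemma tnorm_cancel a u v : 0%:i01 < op a u -> op a u <= op a v -> u <= v.
Proof.
move=> au0 auv; rewrite leNgt; apply/negP => vu.
have [w vE] := tnorm_factor (ltW vu).
have auE : op a u = op a v by apply/eqP; rewrite eq_le auv tnorm_lel// ltW.
have w1 : w < 1%:i01.
  rewrite lt_neqAle i01_le1 andbT; apply/eqP => wE.
  by move: vu; rewrite vE wE tnorm1r ltxx.
have := @tnorm_absorb (op a u) w; rewrite -opA -vE -auE => /(_ erefl w1) E.
by rewrite E ltxx in au0.
Qed.

End Archimedean.

Lemma lt_tnorm_lt1 p c : c < p -> exists2 s, s < 1%:i01 & c < op p s.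
Proof.
by move=> cp; apply: tnorm_lt_sup; rewrite qsup_lt1 tnorm1r.
Qed.

(** * Forward Cauchy nets and Yoneda limits *)

Section Nets.
Context {X : qcat op} {D : Type} (le : D -> D -> Prop) (x : D -> X).
Implicit Types (l g m : D).

Lemma ball_le_radius (b b' : formal_ball X) : ball_le b b' -> b.2 <= b'.2.
Proof. by move=> /le_trans; apply; exact: tnorm_le_left. Qed.

Definition cauchy_modulus l : {i01 R} := qinf [set e | exists g m,
  [/\ le l g, le g m & e = qhom (x g) (x m)]].

Lemma cauchy_modulus_le l g m :
  le l g -> le g m -> cauchy_modulus l <= qhom (x g) (x m).
Proof. by move=> lg gm; apply: qinf_lb; exists g, m. Qed.

Lemma forward_cauchyP : forward_cauchy le x <->
  forall s, s < 1%:i01 -> exists l, s < cauchy_modulus l.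
Proof.
split=> [fc s|H].
  by rewrite -fc => /qsup_gt[_ [l _ <-] sl]; exists l.
apply/eqP; rewrite eq_le i01_le1 leNgt; apply/negP => /H[l].
by apply/negP; rewrite -leNgt; apply: qsup_ub; exists l.
Qed.

Lemma yoneda_limit_gt (a y : X) t : yoneda_limit le x a -> t < qhom a y ->
  exists l, forall m, le l m -> t < qhom (x m) y.
Proof.
move=> /(_ y) -> /qsup_gt[_ [l _ <-] tl]; exists l => m lm.
by apply: lt_le_trans tl _; apply: qinf_lb; exists m.
Qed.

End Nets.

(** * The two completeness notions for an Archimedean t-norm *)

Section ArchimedeanCompleteness.
Hypothesis arch : archimedean_tnorm op.
Variable X : qcat op.

Lemma yoneda_complete_directed_complete :
  yoneda_complete X -> directed_complete (@ball_le R op X).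
Proof.
move=> yc A [[a0 Aa0] dirA].
pose r := qsup [set b.2 | b in A].
have Ar b : A b -> b.2 <= r by move=> Ab; apply: qsup_ub; exists b.
(* When all radii vanish, any member of [A] is a join; otherwise [r] cannot absorb an element below
   1. *)
have [r0|r0] := eqVneq r 0%:i01.
  exists a0; split=> [b /Ar|b]; last exact.
  by rewrite r0 => /le_trans; apply; exact: i01_ge0.
pose D := {b : formal_ball X | A b}.
pose le (d d' : D) := ball_le (sval d) (sval d').
have le_refl : RelationClasses.Reflexive le.
  by move=> d; rewrite /le /ball_le qhom_refl tnorm1r.
have le_pre : RelationClasses.PreOrder le.
  split=> // -[[x1 r1] ?] [[x2 r2] ?] [[x3 r3] ?]; rewrite /le /ball_le /=.
  move=> le12 le23; apply: le_trans le12 _.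
  apply: le_trans (tnorm_ler _ le23) _; rewrite -opA.
  by apply: tnorm_lel; exact: qhom_trans.
have le_dir : directed_set le [set: D].
  split=> [|[b Ab] [c Ac] _ _]; first by exists (exist _ a0 Aa0).
  by have [d [Ad bd cd]] := dirA _ _ Ab Ac; exists (exist _ d Ad).
pose x (d : D) := (sval d).1.
have [|a ax] := yc D le le_pre le_dir x.
  apply/forward_cauchyP => s /i01_dense[t st t1].
  have rt : op r t < r.
    rewrite lt_neqAle tnorm_le_left andbT; apply/eqP.
    by move=> /(tnorm_absorb arch)/(_ t1)/eqP; exact/negP.
  (* Beyond a ball of radius above [op r t], a hom at most [t] between centers would force the
     smaller radius down to [op r t]. *)
  have [_ [b Ab <-] rb] := qsup_gt rt.
  exists (exist _ b Ab); apply: lt_le_trans st _.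
  apply: qinf_ge => _ [g [m [lg gm ->]]].
  rewrite leNgt; apply/negP => /ltW gmt; move: rb; apply/negP; rewrite -leNgt.
  apply: le_trans (ball_le_radius lg) _; apply: le_trans gm _.
  apply: le_trans (tnorm_ler _ (Ar _ (svalP m))) _; exact: tnorm_lel.
exists (a, r); split=> [b Ab|[y s] ub]; rewrite /ball_le /=.
  (* The limit property is tested at [a] itself, where [qhom a a] is 1, so late centers have hom to
     [a] above [t]. *)
  rewrite -[leLHS]tnorm1r -qsup_lt1; apply: tnorm_sup_le => t t1.
  rewrite -(qhom_refl a) in t1.
  have [[l Al] lP] := yoneda_limit_gt ax t1.
  have [c [Ac bc lc]] := dirA _ _ Ab Al.
  have tc := ltW (lP (exist _ c Ac) lc).
  apply: le_trans (tnorm_ler _ bc) _; rewrite -opA.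
  apply: le_trans (tnorm_ler _ (Ar _ Ac)) _; apply: tnorm_lel.
  rewrite opC; apply: le_trans (tnorm_ler _ tc) _; exact: qhom_trans.
apply: qsup_le => _ [b Ab <-]; rewrite ax.
pose d : D := exist _ b Ab.
apply: (le_trans _ (tnorm_lel _ (qsup_ub (ex_intro2 _ _ d I erefl)))).
apply: tnorm_inf_ge => [|_ [m dm <-]].
  by exists (qhom (x d) y); exists d => //; exact: le_refl.
by apply: le_trans (ball_le_radius dm) _; exact: (ub _ (svalP m)).
Qed.

Lemma directed_complete_yoneda_complete :
  directed_complete (@ball_le R op X) -> yoneda_complete X.
Proof.
move=> dc D le [le_refl le_trans'] [_ le_dir] x /forward_cauchyP fc.
have {}le_dir l l' : exists n, le l n /\ le l' n.
  by have [n []] := le_dir l l' I I; exists n.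
pose phi := cauchy_modulus le x.
have phi_mono l n : le l n -> phi l <= phi n.
  move=> ln; apply: qinf_ge => _ [g [m [lg gm ->]]].
  by apply: cauchy_modulus_le gm; exact: le_trans' lg.
have phi_le l n : le l n -> phi l <= qhom (x l) (x n).
  exact: cauchy_modulus_le.
have phi_gt l l' s : s < 1%:i01 -> exists n, [/\ le l n, le l' n & s < phi n].
  move=> /fc[k sk]; have [m [km lm]] := le_dir k l.
  have [n [mn ln]] := le_dir m l'.
  exists n; split=> //; first exact: le_trans' mn.
  by apply: lt_le_trans sk _; apply: phi_mono; exact: le_trans' mn.
have [l0 _] := fc _ i01_lt01.
(* The strict [r < phi l] leaves room for a factor [s < 1], from which upper bounds in [B t] are
   built. *)
pose B t : set (formal_ball X) :=
  [set b | exists l r, r < phi l /\ b = (x l, op t r)].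
have B_join t : exists z, is_join (@ball_le R op X) (B t) z.
  apply: dc; split.
    have [l [_ _ l0P]] := phi_gt l0 l0 _ i01_lt01.
    by exists (x l, op t 0%:i01), l, 0%:i01.
  move=> _ _ [l1 [r1 [rl1 ->]]] [l2 [r2 [rl2 ->]]].
  have [s1 s1_lt1 rs1] := lt_tnorm_lt1 rl1.
  have [s2 s2_lt1 rs2] := lt_tnorm_lt1 rl2.
  pose s := Order.max s1 s2.
  have s_lt1 : s < 1%:i01 by rewrite gt_max s1_lt1 s2_lt1.
  have [n [l1n l2n sn]] := phi_gt l1 l2 _ s_lt1.
  exists (x n, op t s); split; first by exists n, s.
    rewrite /ball_le /= -opA; apply: tnorm_lel.
    apply: le_trans (ltW rs1) _; rewrite opC.
    apply: le_trans (tnorm_lel _ (phi_le _ _ l1n)) _.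
    by apply: tnorm_ler; rewrite le_max lexx.
  rewrite /ball_le /= -opA; apply: tnorm_lel.
  apply: le_trans (ltW rs2) _; rewrite opC.
  apply: le_trans (tnorm_lel _ (phi_le _ _ l2n)) _.
  by apply: tnorm_ler; rewrite le_max lexx orbT.
have B_radius t z : (forall b, B t b -> ball_le b z) -> t <= z.2.
  move=> ub; rewrite -[leLHS]tnorm1r -qsup_lt1; apply: tnorm_sup_le => s s1.
  have [l sl] := fc s s1.
  by apply: (@ball_le_radius _ (x l, op t s)); apply: ub; exists l, s.
have [[a ra] [a_ub a_lub]] := B_join 1%:i01.
have ra1 : ra = 1%:i01 by apply/eqP; rewrite eq_le i01_le1 (B_radius _ _ a_ub).
rewrite {}ra1 in a_ub a_lub.
have phi_a l : phi l <= qhom (x l) a.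
  rewrite leNgt; apply/negP => /i01_dense[m am ml].
  have : ball_le (x l, op 1%:i01 m) (a, 1%:i01) by apply: a_ub; exists l, m.
  by rewrite /ball_le /= !op1l leNgt am.
exists a => y; apply/eqP; rewrite eq_le; apply/andP; split.
  (* Past [l] the hom to [a] is at least [s]; composing with [qhom a y] bounds the whole tail. *)
  rewrite -[leLHS]tnorm1r -qsup_lt1; apply: tnorm_sup_le => s /fc[l sl].
  apply: (le_trans _ (qsup_ub (ex_intro2 _ _ l I erefl))).
  apply: qinf_ge => _ [m lm <-]; apply: le_trans _ (qhom_trans _ a _).
  apply: tnorm_lel; apply: le_trans (ltW sl) _.
  by apply: le_trans (phi_mono _ _ lm) _.
set t := qsup _.
have [->|t0] := eqVneq t 0%:i01; first exact: i01_ge0.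
have y_ub b : B t b -> ball_le b (y, 1%:i01).
  move=> [l [r [rl ->]]]; rewrite /ball_le /= op1l.
  apply: le_trans (tnorm_lel _ (ltW rl)) _; rewrite opC.
  apply: tnorm_sup_le => _ [l' _ <-]; have [m [lm lm']] := le_dir l l'.
  apply: le_trans _ (qhom_trans _ (x m) _).
  apply: le_trans (tnorm_ler _ (phi_le _ _ lm)) _; rewrite opC.
  by apply: tnorm_ler; apply: qinf_lb; exists m.
have [[z b] [z_ub z_lub]] := B_join t.
(* The ball [(a, t)] also bounds [B t], so the radius of the join is at most [t]. *)
have bt : b = t.
  apply/eqP; rewrite eq_le (B_radius _ _ z_ub) andbT.
  apply: (@ball_le_radius _ (z, b) (a, t)); apply: z_lub => _ [l [r [rl ->]]].
  by apply: tnorm_lel; apply: le_trans (ltW rl) _.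
rewrite {}bt in z_ub z_lub.
have tzy : t <= qhom z y by have := z_lub _ y_ub; rewrite /ball_le /= op1l.
(* This says [qhom a z = 1], which carries [t <= qhom z y] over to [qhom a y]. *)
have : ball_le (a, 1%:i01) (z, 1%:i01).
  apply: a_lub => _ [l [r [rl ->]]]; rewrite /ball_le /= !op1l.
  have [s1 s1_lt1 rs1] := lt_tnorm_lt1 rl.
  have [s2 s2_lt1 ts2] : exists2 s, s < 1%:i01 & 0%:i01 < op t s.
    by apply: lt_tnorm_lt1; rewrite lt_neqAle eq_sym t0 i01_ge0.
  (* Cancellation of [t] needs [t & s] nonzero, hence the passage to a later
     ball of radius at least [s2]. *)
  pose s := Order.max s1 s2.
  have s_lt1 : s < 1%:i01 by rewrite gt_max s1_lt1 s2_lt1.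
  have [n [ln _ sn]] := phi_gt l l _ s_lt1.
  have snz : s <= qhom (x n) z.
    have : ball_le (x n, op t s) (z, t) by apply: z_ub; exists n, s.
    apply: (tnorm_cancel arch); apply: lt_le_trans ts2 _; apply: tnorm_lel.
    by rewrite le_max lexx orbT.
  apply: le_trans _ (qhom_trans _ (x n) _).
  apply: le_trans (ltW rs1) _; rewrite opC.
  apply: le_trans (tnorm_lel _ (phi_le _ _ ln)) _.
  by apply: tnorm_ler; apply: le_trans snz; rewrite le_max lexx.
rewrite /ball_le /= op1l => az.
apply: le_trans tzy _; rewrite -[leLHS]tnorm1r.
by apply: le_trans _ (qhom_trans _ z _); exact: tnorm_lel.
Qed.

End ArchimedeanCompleteness.

(** * The counterexample built from an idempotent *)

Section IdempotentChain.
Variable e : {i01 R}.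
Hypotheses (e0 : 0%:i01 < e) (e1 : e < 1%:i01) (ee : op e e = e).

Definition chain_hom (n m : nat) : {i01 R} :=
  if n == m then 1%:i01 else if (n < m)%N then e else 0%:i01.

Lemma chain_hom_refl n : chain_hom n n = 1%:i01.
Proof. by rewrite /chain_hom eqxx. Qed.

Lemma chain_hom_gt n m : (m < n)%N -> chain_hom n m = 0%:i01.
Proof. by rewrite /chain_hom; case: ltngtP. Qed.

Lemma chain_hom_neq n m : n != m -> chain_hom n m <= e.
Proof. by rewrite /chain_hom => /negPf ->; case: ifP => // _; exact: ltW. Qed.

Lemma chain_hom_le n m : (n <= m)%N -> e <= chain_hom n m.
Proof. by rewrite /chain_hom; case: ltngtP => // _ _; exact: ltW. Qed.

(** If [n < k], one factor joins distinct points and is at most [e]; if [k < n], one factor goes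
    strictly down and is 0. *)
Lemma chain_hom_trans n m k :
  op (chain_hom m k) (chain_hom n m) <= chain_hom n k.
Proof.
have [nk|kn|->] := ltngtP n k; last by rewrite chain_hom_refl i01_le1.
  apply: le_trans (chain_hom_le (ltnW nk)).
  have [nm|nm] := eqVneq n m.
    apply: le_trans (tnorm_le_left _ _) _; apply: chain_hom_neq.
    by rewrite -nm neq_ltn nk.
  by apply: le_trans (tnorm_le_right _ _) _; exact: chain_hom_neq.
have [mn|nm] := ltnP m n.
  rewrite (chain_hom_gt mn); apply: le_trans (tnorm_le_right _ _) _.
  exact: i01_ge0.
rewrite (chain_hom_gt (leq_trans kn nm)).
by apply: le_trans (tnorm_le_left _ _) _; exact: i01_ge0.
Qed.

Definition chain_qcat : qcat op := QCat chain_hom_refl chain_hom_trans.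

Lemma chain_yoneda_complete : yoneda_complete chain_qcat.
Proof.
move=> D le [le_refl _] [_ le_dir] x /forward_cauchyP fc.
(* A modulus above [e] forces equality, as distinct points have hom at most [e]. *)
have [l el] := fc e e1.
have xl m : le l m -> x m = x l.
  move=> lm; apply/esym/eqP; apply: contraT => /chain_hom_neq; rewrite leNgt.
  by rewrite (lt_le_trans el)//; apply: cauchy_modulus_le.
exists (x l) => y; apply/eqP; rewrite eq_le; apply/andP; split.
  apply: (le_trans _ (qsup_ub (ex_intro2 _ _ l I erefl))).
  by apply: qinf_ge => _ [m /xl -> <-].
apply: qsup_le => _ [k _ <-]; have [m [_ km lm]] := le_dir k l I I.
by rewrite -(xl _ lm); apply: qinf_lb; exists m.
Qed.

Lemma chain_not_directed_complete :
  ~ directed_complete (@ball_le R op chain_qcat).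
Proof.
have ball_chain (n m : chain_qcat) : (n <= m)%N -> ball_le (n, e) (m, e).
  move=> nm; rewrite /ball_le /= -[leLHS]ee.
  by apply: tnorm_lel; exact: chain_hom_le.
move=> /(_ (range (fun n : chain_qcat => (n, e))))[|[k s] [ub _]].
  split=> [|_ _ [n _ <-] [m _ <-]]; first by exists (0%N : chain_qcat, e), 0%N.
  exists (maxn n m : chain_qcat, e); split; first by exists (maxn n m).
    by apply: ball_chain; exact: leq_maxl.
  by apply: ball_chain; exact: leq_maxr.
(* The hom from [k.+1] back to [k] is 0, so an upper bound centered at [k] would give [e <= 0]. *)
have /ub : range (fun n : chain_qcat => (n, e)) (k.+1, e) by exists k.+1.
rewrite /ball_le /= chain_hom_gt// => /le_trans/(_ (tnorm_le_right _ _)).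
by rewrite leNgt e0.
Qed.

End IdempotentChain.
End ContinuousTNorm.

Theorem corollary4p9 (R : realType) (op : {i01 R} -> {i01 R} -> {i01 R})
    (hop : continuous_tnorm op) :
  archimedean_tnorm op <->
  (forall X : qcat op,
     yoneda_complete X <-> directed_complete (@ball_le R op X)).
Proof.
split=> [arch X|H].
  split; first exact: yoneda_complete_directed_complete.
  exact: directed_complete_yoneda_complete.
apply: contrapT => /(idempotent_of_not_archimedean hop)[e [e0 e1 ee]].
apply: (@chain_not_directed_complete _ _ hop e e0 e1 ee).
by apply/(H _); exact: chain_yoneda_complete.
Qed.
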